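(* Let $B_1,\dots,B_t$ be a family of monomial ideals in $S$, let $\mathcal{C}=\{\mathbf{c}_1,\dots,\mathbf{c}_l\}\subseteq G=\mathbb{Z}^r$ be a nonempty finite set, and for each $\emptyset\ne I\subseteq[t]=\{1,\dots,t\}$ let $\mathbf{v}_I\in G$ be a coarsening vector for $S$. Let $M$ be a $G$-graded $S$-module. If $\mathbf{v}_I\cdot\mathbf{c}_j\ge0$ for all $\emptyset\ne I\subseteq[t]$ and all $\mathbf{c}_j\in\mathcal{C}$, then $$\mathrm{reg}_{B_*,\mathbf{v}_*,\mathcal{C}}(M)\subseteq\mathrm{reg}_{B_*,\mathcal{C}}(M).$$ If moreover $B$ is a monomial ideal of $S$ with $\mathbb{V}(B)=\bigcup_{i=1}^t\mathbb{V}(B_i)$, then $$\mathrm{reg}_{B_*,\mathbf{v}_*,\mathcal{C}}(M)\subseteq\mathrm{reg}_{B,\mathcal{C}}(M).$$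
   Context: $R$ is a commutative Noetherian ring, $G=\mathbb{Z}^r$, and $S=R[x_1,\dots,x_n]$ is a $G$-graded polynomial $R$-algebra (each $x_i$ homogeneous, $R$ in degree $\mathbf 0$). $\mathbb{V}(\cdot)$ denotes the closed subset of $\mathrm{Spec}(S)$ defined by an ideal. For $\emptyset\ne I\subseteq[t]$ put $B_I=\sum_{i\in I}B_i$. A vector $\mathbf{v}\in\mathbb{Z}^r$ is a coarsening vector for $S$ if $\mathbf{v}\cdot\deg(x_i)\ge0$ for all $i$ (zero values allowed); $\deg_{\mathbf{v}}(\mathbf{d})=\mathbf{v}\cdot\mathbf{d}$. $\mathbb{N}=\mathbb{Z}_{\ge0}$; $\mathbb{N}\mathcal{C}$ is the sub-semigroup of $G$ (containing $\mathbf{0}$) generated by $\mathcal{C}$; for $j\in\mathbb{Z}$, $\mathbb{N}\mathcal{C}[j]=\bigcup_{\mathbf{w}\in\mathbb{N}^l,\ \sum w_i=|j|}(\mathrm{sign}(j)\sum_iw_i\mathbf{c}_i+\mathbb{N}\mathcal{C})$, with $\mathbb{N}\mathcal{C}[0]=\mathbb{N}\mathcal{C}$. For a $G$-graded ideal $A\subset S$, $\mathcal{Z}^i_A(M)=\{\mathbf{p}\in G:H^i_A(M)_{\mathbf{p}}=0\}$ with $H^i_A$ the $G$-graded local cohomology, and $\mathrm{reg}_{A,\mathcal{C}}(M)=\{\mathbf{m}\in G:\mathbf{m}+\mathbb{N}\mathcal{C}[1-i]\subseteq\mathcal{Z}^i_A(M)\ \forall i\ge0\}$. $\mathrm{reg}_{B_*,\mathcal{C}}(M)$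 is the set of $\mathbf{m}\in G$ with $\mathbf{m}+\mathbb{N}\mathcal{C}[1-i]\subseteq\mathcal{Z}^{i+\#I-1}_{B_I}(M)$ for all $i\ge0$ and all $\emptyset\ne I\subseteq[t]$. $\mathrm{reg}_{B_*,\mathbf{v}_*,\mathcal{C}}(M)$ is the set of $\mathbf{m}\in G$ such that for all $i\ge0$ and all $\emptyset\ne I\subseteq[t]$, $$H^i_{B_I}(M)_{\mathbf{d}}=0\ \text{for all }\mathbf{d}\in G\text{ with }\deg_{\mathbf{v}_I}(\mathbf{d})\ge\deg_{\mathbf{v}_I}(\mathbf{m})+(1-i)\,m_I(1,i),$$ where $m_I(1,i)=\max_j(\mathbf{v}_I\cdot\mathbf{c}_j)$ if $1-i<0$ and $m_I(1,i)=\min_j(\mathbf{v}_I\cdot\mathbf{c}_j)$ if $1-i\ge0$. *)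

(* Defs.v *)
From mathcomp Require Import all_boot all_order all_algebra.
From mathcomp.multinomials Require Import mpoly.

Set Implicit Arguments.
Unset Strict Implicit.
Unset Printing Implicit Defensive.

Import Order.TTheory GRing.Theory Num.Theory.
Local Open Scope ring_scope.

(* Ideals are [Prop]-valued predicates rather than boolean ones, so that no
   decidability of membership is presupposed. *)

Section Ideals.
Variable A : comNzRingType.

Definition is_ideal (J : A -> Prop) : Prop :=
  [/\ J 0, forall a b, J a -> J b -> J (a + b) & forall a b, J b -> J (a * b)].

Definition generated_ideal (X : A -> Prop) (f : A) : Prop :=
  exists (k : nat) (a g : 'I_k -> A),
    (forall j, X (g j)) /\ f = \sum_(j < k) a j * g j.

Definition noetherian : Prop :=
  forall J : A -> Prop, is_ideal J ->
    exists (k : nat) (g : 'I_k -> A),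
      forall f, J f <-> generated_ideal (fun h => exists j, h = g j) f.

(* For k = 0 the only generator is the empty product 1, so J ^ 0 = A. *)
Definition ideal_pow (J : A -> Prop) (k : nat) : A -> Prop :=
  generated_ideal
    (fun h => exists a : 'I_k -> A, (forall j, J (a j)) /\ h = \prod_(j < k) a j).

Definition ideal_sum (T : finType) (B : T -> A -> Prop) (I : {set T}) (f : A)
  : Prop :=
  exists b : T -> A, (forall j, j \in I -> B j (b j)) /\ f = \sum_(j in I) b j.

Definition is_prime_ideal (P : A -> Prop) : Prop :=
  [/\ is_ideal P, ~ P 1 & forall a b, P (a * b) -> P a \/ P b].

Definition in_V (J P : A -> Prop) : Prop :=
  is_prime_ideal P /\ forall f, J f -> P f.

End Ideals.

Definition is_monomial_ideal (R : comNzRingType) (n : nat)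
    (J : {mpoly R[n]} -> Prop) : Prop :=
  exists X : 'X_{1..n} -> Prop,
    forall f, J f <-> generated_ideal (fun h => exists m, X m /\ h = 'X_[R, m]) f.

Section Graded.
Variables (R : comNzRingType) (n r : nat) (deg : 'I_n -> 'rV[int]_r).
Local Notation S := {mpoly R[n]}.
Local Notation G := 'rV[int]_r.

Definition multideg (m : 'X_{1..n}) : G := \sum_(i < n) deg i *+ m i.

Definition homog_poly (d : G) (f : S) : Prop :=
  forall m, m \in msupp f -> multideg m = d.

Record gmod : Type := GMod {
  gmod_car :> lmodType S;
  gcomp : G -> gmod_car -> Prop;
  gcomp0 : forall d, gcomp d 0;
  gcompB : forall d x y, gcomp d x -> gcomp d y -> gcomp d (x - y);
  gcompZ : forall e d f x, homog_poly e f -> gcomp d x -> gcomp (e + d) (f *: x);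
  gcomp_span : forall x, exists (s : seq G) (y : G -> gmod_car),
    (forall d, gcomp d (y d)) /\ x = \sum_(d <- s) y d;
  gcomp_direct : forall (s : seq G) (y : G -> gmod_car),
    uniq s -> (forall d, gcomp d (y d)) -> \sum_(d <- s) y d = 0 ->
    forall d, d \in s -> y d = 0
}.

Definition graded_map (M N : gmod) (f : {linear M -> N}) : Prop :=
  forall d x, gcomp d x -> gcomp d (f x).

(* Injective objects of the category of G-graded S-modules and maps of
   degree 0. *)
Definition graded_injective (E : gmod) : Prop :=
  forall (X Y : gmod) (j : {linear X -> Y}) (f : {linear X -> E}),
    graded_map j -> injective j -> graded_map f ->
    exists g : {linear Y -> E}, graded_map g /\ forall x, g (j x) = f x.

Record injective_resolution (M : gmod) : Type := InjectiveResolution {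
  res_obj :> nat -> gmod;
  res_aug : {linear M -> res_obj 0%N};
  res_diff : forall i, {linear res_obj i -> res_obj i.+1};
  res_aug_graded : graded_map res_aug;
  res_diff_graded : forall i, graded_map (res_diff i);
  res_injective : forall i, graded_injective (res_obj i);
  res_aug_inj : injective res_aug;
  res_exact0 : forall x, res_diff 0 x = 0 <-> exists y, x = res_aug y;
  res_exactS : forall i x, res_diff i.+1 x = 0 <-> exists y, x = res_diff i y
}.

(* The A-torsion functor Gamma_A, whose right derived functors are the H^i_A. *)
Definition torsion (A : S -> Prop) (M : gmod) (x : M) : Prop :=
  exists k, forall a, ideal_pow A k a -> a *: x = 0.

Definition lc_cocycle (A : S -> Prop) (M : gmod) (E : injective_resolution M)
    (i : nat) (p : G) (x : E i) : Prop :=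
  [/\ gcomp p x, torsion A x & res_diff E i x = 0].

Definition lc_coboundary (A : S -> Prop) (M : gmod) (E : injective_resolution M)
    (i : nat) (p : G) : E i -> Prop :=
  match i return E i -> Prop with
  | 0%N => fun x => x = 0
  | j.+1 => fun x =>
      exists y : E j, [/\ gcomp p y, torsion A y & x = res_diff E j y]
  end.

(* [lc_zero A M i p] is H^i_A(M)_p = 0, where H^i_A(M) = H^i(Gamma_A(E)) for a
   graded injective resolution E of M.  Graded modules have enough injectives
   and the cohomology does not depend on E up to isomorphism, so requiring the
   vanishing for every E is the same as requiring it for one E. *)
Definition lc_zero (A : S -> Prop) (M : gmod) (i : nat) (p : G) : Prop :=
  forall (E : injective_resolution M) (x : E i),
    lc_cocycle A p x -> lc_coboundary A p x.

End Graded.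

Section Regularity.
Variables (R : comNzRingType) (n r : nat) (deg : 'I_n -> 'rV[int]_r).
Local Notation S := {mpoly R[n]}.
Local Notation G := 'rV[int]_r.

Definition dot (v d : G) : int := \sum_(k < r) v 0 k * d 0 k.

Definition coarsening_vector (v : G) : Prop := forall i, 0 <= dot v (deg i).

(* The nonempty finite set C is enumerated as c_0, ..., c_l. *)
Variables (l : nat) (c : 'I_l.+1 -> G).

Definition NC (d : G) : Prop :=
  exists w : 'I_l.+1 -> nat, d = \sum_j c j *+ w j.

Definition NCshift (j : int) (d : G) : Prop :=
  exists (w : 'I_l.+1 -> nat) (u : G),
    [/\ (\sum_i w i = `|j|)%N, NC u & d = (\sum_i c i *+ w i) *~ sgz j + u].

Definition max_dot (v : G) : int :=
  \big[Num.max/dot v (c ord0)]_(j < l.+1) dot v (c j).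

Definition min_dot (v : G) : int :=
  \big[Num.min/dot v (c ord0)]_(j < l.+1) dot v (c j).

Definition slope (v : G) (i : nat) : int :=
  if 1 - i%:Z < 0 then max_dot v else min_dot v.

Variable M : gmod R deg.

Definition reg (A : S -> Prop) (m : G) : Prop :=
  forall (i : nat) (d : G), NCshift (1 - i%:Z) d -> lc_zero A M i (m + d).

Variables (t : nat) (B : 'I_t -> S -> Prop).

Definition reg_family (m : G) : Prop :=
  forall (i : nat) (I : {set 'I_t}), I != set0 ->
  forall d : G, NCshift (1 - i%:Z) d ->
    lc_zero (ideal_sum B I) M (i + #|I| - 1)%N (m + d).

Definition reg_coarse (v : {set 'I_t} -> G) (m : G) : Prop :=
  forall (i : nat) (I : {set 'I_t}), I != set0 ->
  forall d : G, dot (v I) m + (1 - i%:Z) * slope (v I) i <= dot (v I) d ->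
    lc_zero (ideal_sum B I) M i d.

End Regularity.

(* Main.v *)
Require Import Defs.
From mathcomp Require Import all_boot all_order all_algebra.
From mathcomp.multinomials Require Import mpoly.
From HB Require Import structures.
From mathcomp Require classical_sets.
From Stdlib Require Import Classical.

Set Implicit Arguments.
Unset Strict Implicit.
Unset Printing Implicit Defensive.

Import Order.TTheory GRing.Theory Num.Theory.
Local Open Scope ring_scope.

(* The first inclusion is a comparison of linear bounds: [dot v d] for
   [d] in [NCshift (1 - i)] dominates the slope bound at every index
   [k >= i], in particular at [k = i + #|I| - 1].

   For the second, torsion with respect to a monomial ideal depends only on the
   up-set of supports of its monomials. Sums of ideals become unions of up-sets,
   and primes of [S] that are preimages of a prime of [R] under evaluation at
   0/1 points show that [V(B0) = union of the V(B_j)] makes the up-set of [B0]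
   the intersection of those of the [B_j]. On a graded injective module, torsion
   for [U :&: V] is the sum of [U]- and [V]-torsion, which yields Mayer-Vietoris
   in each degree. Induction on the number of ideals, using the distributivity
   of unions over intersections, then replaces the usual spectral sequence. *)

(** * Truncated polynomials *)

Section Truncation.
Variables (R : comNzRingType) (n : nat) (P : pred 'X_{1..n}).
Local Notation S := {mpoly R[n]}.

Definition trunc (f : S) : S := \sum_(m <- msupp f | P m) f@_m *: 'X_[m].

Lemma mcoeff_trunc m f : (trunc f)@_m = if P m then f@_m else 0.
Proof.
rewrite /trunc raddf_sum /=.
under eq_bigr => k _ do rewrite mcoeffZ mcoeffX.
have [mf|mf] := boolP (m \in msupp f).
  rewrite big_mkcond (bigD1_seq m) ?msupp_uniq //= eqxx mulr1 big1 ?addr0 //.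
  by move=> k /negPf ->; rewrite mulr0; case: ifP.
rewrite (memN_msupp_eq0 mf) if_same big_seq_cond big1 // => k /andP[kf _].
by case: eqP kf mf => [-> ->|]; rewrite ?mulr0.
Qed.

Lemma trunc_is_zmod_morphism : zmod_morphism trunc.
Proof.
move=> f g; apply/mpolyP => m; rewrite mcoeffB !mcoeff_trunc mcoeffB.
by case: ifP; rewrite ?subr0.
Qed.

HB.instance Definition _ :=
  GRing.isZmodMorphism.Build S S trunc trunc_is_zmod_morphism.

Lemma trunc_idem f : trunc (trunc f) = trunc f.
Proof. by apply/mpolyP => m; rewrite !mcoeff_trunc; case: (P m). Qed.

Lemma msupp_trunc m f : (m \in msupp (trunc f)) = P m && (m \in msupp f).
Proof. by rewrite !mcoeff_msupp mcoeff_trunc; case: ifP; rewrite ?eqxx. Qed.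

(** Convexity for divisibility: [P] contains every monomial lying between two of its members. *)
Definition convex := forall a b m,
  P m -> P (a + (b + m))%MM -> P (b + m)%MM.

Lemma msuppMP (f g : S) m : m \in msupp (f * g) ->
  exists a b, [/\ a \in msupp f, b \in msupp g & m = (a + b)%MM].
Proof. by move=> /msuppM_le /allpairsP[[a b] /= [af bg ->]]; exists a, b. Qed.

(** A monomial of [b * f] dropped by the inner truncation is a multiple of a member of [P]. By
    convexity none of its multiples returns to [P], so dropping it early does no harm. *)
Lemma trunc_mul a b f : convex -> trunc f = f ->
  trunc (a * trunc (b * f)) = trunc (a * (b * f)).
Proof.
move=> cP fP; apply/eqP; rewrite -subr_eq0 -raddfB -mulrBr.
apply/eqP/mpolyP => m; rewrite mcoeff_trunc mcoeff0; case: ifP => // Pm.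
apply: memN_msupp_eq0; apply/negP => /msuppMP[k [l [_ lh mE]]].
have [Pl|NPl] := boolP (P l).
  by move: lh; rewrite mcoeff_msupp mcoeffB mcoeff_trunc Pl subrr eqxx.
have /msuppMP[k' [l' [_ lf lE]]]: l \in msupp (b * f).
  move: lh; rewrite !mcoeff_msupp mcoeffB mcoeff_trunc (negPf NPl).
  by rewrite sub0r oppr_eq0.
move: lf; rewrite -fP msupp_trunc => /andP[Pl' _].
by move: NPl; rewrite lE (cP k) // -lE -mE.
Qed.

Lemma trunc_mulr (a f : S) : (forall b m, P (b + m)%MM -> P m) ->
  trunc (a * trunc f) = trunc (a * f).
Proof.
move=> dP; apply/eqP; rewrite -subr_eq0 -raddfB -mulrBr.
apply/eqP/mpolyP => m; rewrite mcoeff_trunc mcoeff0; case: ifP => // Pm.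
apply: memN_msupp_eq0; apply/negP => /msuppMP[k [l [_ lh mE]]].
move: lh; rewrite mcoeff_msupp mcoeffB mcoeff_trunc (dP k) ?subrr ?eqxx //.
by rewrite -mE.
Qed.

End Truncation.

(* Multiplication followed by truncation; for [P] the complement of an up-set
   this is a model of the quotient by a monomial ideal, and in general of a
   subquotient. *)
Record tpoly (R : comNzRingType) (n : nat) (P : pred 'X_{1..n})
    (cP : convex P) :=
  TPoly { tval : {mpoly R[n]}; _ : trunc P tval == tval }.

Section TPoly.
Variables (R : comNzRingType) (n : nat) (P : pred 'X_{1..n}) (cP : convex P).
Local Notation S := {mpoly R[n]}.
Local Notation T := (tpoly R cP).

HB.instance Definition _ := [isSub for @tval R n P cP].
HB.instance Definition _ := [Choice of T by <:].

Lemma tpoly_zmod_closed : zmod_closed (fun f : S => trunc P f == f).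
Proof.
split; first by rewrite /in_mem /= raddf0.
move=> f g /eqP fP /eqP gP; apply/eqP.
by transitivity (trunc P f - trunc P g); [exact: raddfB | congr (_ - _)].
Qed.

HB.instance Definition _ :=
  GRing.SubChoice_isSubZmodule.Build S _ T tpoly_zmod_closed.

Lemma tvalK (x : T) : trunc P (val x) = val x.
Proof. exact/eqP/(valP x). Qed.

Lemma truncP (f : S) : trunc P (trunc P f) == trunc P f.
Proof. by rewrite trunc_idem. Qed.

Definition to_tpoly (f : S) : T := TPoly cP (truncP f).

Definition tscale (a : S) (x : T) : T := to_tpoly (a * val x).

Lemma tscaleA a b x : tscale a (tscale b x) = tscale (a * b) x.
Proof. by apply: val_inj; rewrite /= (trunc_mul _ _ cP (tvalK x)) mulrA. Qed.

Lemma tscale1 : left_id 1 tscale.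
Proof. by move=> x; apply: val_inj; rewrite /= mul1r tvalK. Qed.

Lemma tscaleDr : right_distributive tscale +%R.
Proof.
move=> a x y; apply: val_inj.
rewrite raddfD /= -[RHS](raddfD (trunc P)) -mulrDr.
by congr (trunc P (_ * _)).
Qed.

Lemma tscaleDl x : {morph tscale^~ x : a b / a + b}.
Proof.
move=> a b; apply: val_inj; rewrite raddfD /= -[RHS](raddfD (trunc P)).
by rewrite -mulrDl.
Qed.

HB.instance Definition _ :=
  GRing.Zmodule_isLmodule.Build S T tscaleA tscale1 tscaleDr tscaleDl.

Lemma val_tscale a (x : T) : val (a *: x) = trunc P (a * val x).
Proof. by []. Qed.

Lemma msupp_tval (x : T) m : m \in msupp (val x) -> P m.
Proof. by rewrite -tvalK msupp_trunc => /andP[]. Qed.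

Variables (r : nat) (deg : 'I_n -> 'rV[int]_r) (p : 'rV[int]_r).
Local Notation G := 'rV[int]_r.

(** The shift by [p] puts the class of 1 in degree [p], so that [f |-> f x] preserves degrees when
    [x] has degree [p]. *)
Definition tcomp (d : G) (x : T) : Prop :=
  forall m, m \in msupp (val x) -> multideg deg m + p = d.

Lemma tcomp0 d : tcomp d 0.
Proof. by move=> m; rewrite raddf0 mcoeff_msupp mcoeff0 eqxx. Qed.

Lemma tcompB d x y : tcomp d x -> tcomp d y -> tcomp d (x - y).
Proof.
move=> dx dy m; rewrite raddfB => /msuppB_le; rewrite mem_cat.
by case/orP=> [/dx|/dy].
Qed.

Lemma multidegD a b : multideg deg (a + b)%MM = multideg deg a + multideg deg b.
Proof.
by rewrite -big_split; apply: eq_bigr => i _; rewrite mnmDE mulrnDr.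
Qed.

Lemma tcompZ e d f x : homog_poly deg e f -> tcomp d x -> tcomp (e + d) (f *: x).
Proof.
move=> ef dx m; rewrite val_tscale msupp_trunc => /andP[_].
case/msuppMP => a [b [/ef <- /dx <- ->]].
by rewrite multidegD addrA.
Qed.

Lemma tcomp_span x : exists (s : seq G) (y : G -> T),
  (forall d, tcomp d (y d)) /\ x = \sum_(d <- s) y d.
Proof.
pose D d := fun m => multideg deg m + p == d.
exists (undup [seq multideg deg m + p | m <- msupp (val x)]).
exists (fun d => to_tpoly (trunc (D d) (val x))); split.
  by move=> d m; rewrite /= !msupp_trunc => /and3P[_ /eqP].
apply: val_inj; rewrite raddf_sum; apply/mpolyP => m; rewrite raddf_sum /=.
under eq_bigr => d _ do rewrite !mcoeff_trunc.
have [mx|mx] := boolP (m \in msupp (val x)); last first.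
  rewrite (memN_msupp_eq0 mx) big1 // => d _; by rewrite !if_same.
rewrite (bigD1_seq (multideg deg m + p)) ?undup_uniq //=; last first.
  by rewrite mem_undup; apply/mapP; exists m.
rewrite (msupp_tval mx) /D eqxx big1 ?addr0 // => d.
by rewrite eq_sym => /negPf ->.
Qed.

Lemma tcomp_direct (s : seq G) (y : G -> T) :
  uniq s -> (forall d, tcomp d (y d)) -> \sum_(d <- s) y d = 0 ->
  forall d, d \in s -> y d = 0.
Proof.
move=> us yc sy d ds; apply: val_inj; rewrite raddf0; apply/mpolyP => m.
rewrite mcoeff0; have [my|] := boolP (m \in msupp (val (y d))); last first.
  exact: memN_msupp_eq0.
have /(congr1 val)/mpolyP/(_ m) := sy.
rewrite (raddf_sum val) raddf_sum /= mcoeff0 (bigD1_seq d) //= big1 ?addr0 //.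
move=> e ne; apply: memN_msupp_eq0; apply: contraNN ne => /yc <-.
by rewrite (yc _ _ my).
Qed.

Definition tgmod : gmod R deg :=
  GMod tcomp0 tcompB tcompZ tcomp_span tcomp_direct.

End TPoly.

(** * Torsion and up-sets of supports *)

Definition mk_linear (R : nzRingType) (U V : lmodType R) (f : U -> V)
    (lf : linear f) : {linear U -> V} :=
  HB.pack f (GRing.isLinear.Build R U V _ f lf).

Section Levels.
Variable n : nat.

(** [lev 1 m] is the support of [m]; higher thresholds [N] stand in for powers of an ideal. *)
Definition lev (N : nat) (m : 'X_{1..n}) : {set 'I_n} := [set i | (N <= m i)%N].

Definition upset (U : {set {set 'I_n}}) : Prop :=
  forall s s' : {set 'I_n}, s \subset s' -> s \in U -> s' \in U.

Lemma lev_anti N N' m : (N <= N')%N -> lev N' m \subset lev N m.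
Proof.
by move=> le; apply/subsetP => i; rewrite !inE; apply: leq_trans.
Qed.

Lemma lev_addl N a m : lev N m \subset lev N (a + m)%MM.
Proof.
apply/subsetP => i; rewrite !inE mnmDE => /leq_trans; apply.
exact: leq_addl.
Qed.

Lemma upsetU U V : upset U -> upset V -> upset (U :|: V).
Proof.
move=> uU uV s s' ss'; rewrite !inE.
case/orP=> [/(uU _ _ ss') ->|/(uV _ _ ss') ->] //.
by rewrite orbT.
Qed.

Lemma upsetI U V : upset U -> upset V -> upset (U :&: V).
Proof.
by move=> uU uV s s' ss'; rewrite !inE => /andP[/(uU _ _ ss') -> /(uV _ _ ss')].
Qed.

End Levels.

Section Torsion.
Variables (R : comNzRingType) (n r : nat) (deg : 'I_n -> 'rV[int]_r).
Local Notation S := {mpoly R[n]}.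
Local Notation G := 'rV[int]_r.

(* Torsion with respect to the squarefree monomial ideal generated by the
   products of variables over the members of [U]; the monomials of level in [U]
   span its Frobenius-type power of exponent [N]. *)
Definition utors (U : {set {set 'I_n}}) (M : lmodType S) (x : M) : Prop :=
  exists N, forall m, lev N m \in U -> 'X_[m] *: x = 0.

Lemma scaler_msupp (M : lmodType S) (f : S) (x : M) :
  (forall m, m \in msupp f -> 'X_[m] *: x = 0) -> f *: x = 0.
Proof.
move=> fx; rewrite (mpolyE f) scaler_suml big_seq big1 // => m mf.
by rewrite -mul_mpolyC -scalerA fx // scaler0.
Qed.

Lemma utorsB U (M : lmodType S) (x y : M) :
  upset U -> utors U x -> utors U y -> utors U (x - y).
Proof.
move=> uU [N Nx] [N' Ny]; exists (maxn N N') => m mU.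
rewrite scalerBr Nx ?Ny ?subr0 //; apply: uU mU; apply: lev_anti.
  exact: leq_maxr.
exact: leq_maxl.
Qed.

Lemma utors0 U (M : lmodType S) : utors U (0 : M).
Proof. by exists 0%N => m _; rewrite scaler0. Qed.

Lemma utors_linear U (M N : lmodType S) (f : {linear M -> N}) x :
  utors U x -> utors U (f x).
Proof. by case=> k kx; exists k => m /kx mx; rewrite -linearZ mx linear0. Qed.

Lemma utorsU U V (M : lmodType S) (x : M) : upset U -> upset V ->
  utors (U :|: V) x <-> utors U x /\ utors V x.
Proof.
move=> uU uV; split=> [[N Nx]|[[N Nx] [N' Nx']]].
  by split; exists N => m mU; apply: Nx; rewrite inE mU ?orbT.
exists (maxn N N') => m; rewrite inE => /orP[mU|mV].
  by apply/Nx/(uU _ _ _ mU)/lev_anti/leq_maxl.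
by apply/Nx'/(uV _ _ _ mV)/lev_anti/leq_maxr.
Qed.

Lemma utorsT (M : lmodType S) (x : M) : utors setT x -> x = 0.
Proof. by case=> N /(_ 0%MM (in_setT _)); rewrite mpolyX0 scale1r. Qed.

(* [J_V / (J_U :&: J_V)] embeds into [S / J_U], where [J_U] and [J_V] are spanned
   by the monomials of level in [U] and [V]. The map [f |-> f x] on the former
   extends to the latter, and the image of [1] is the [U]-torsion part of [x]. *)
Lemma utorsI_decomp U V (E : gmod R deg) (p : G) (x : E) :
  upset U -> upset V -> graded_injective E -> gcomp p x -> utors (U :&: V) x ->
  exists y z, [/\ gcomp p y, gcomp p z, utors U y, utors V z & x = y + z].
Proof.
move=> uU uV injE px [N Nx].
pose PY := [pred m : 'X_{1..n} | lev N m \notin U].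
pose PX := [pred m : 'X_{1..n} | (lev N m \in V) && (lev N m \notin U)].
have cY : convex PY.
  by move=> a b m /= _; apply: contra; apply: uU; apply: lev_addl.
have cX : convex PX.
  move=> a b m /= /andP[mV _] /andP[_ mU]; apply/andP; split.
    by apply: uV mV; apply: lev_addl.
  by apply: contra mU; apply: uU; apply: lev_addl.
pose X := tgmod R cX deg p; pose Y := tgmod R cY deg p.
have XYE (g : tpoly R cX) : trunc PY (val g) = val g.
  apply/mpolyP => m; rewrite mcoeff_trunc; case: ifP => // mY.
  apply/esym/memN_msupp_eq0; apply/negP => /msupp_tval /andP[_].
  by rewrite -[_ \notin _]/(PY m) mY.
(* On such products the truncations by [PX] and [PY] agree, which makes the inclusion [j] linear. *)
have mulV a (g : tpoly R cX) m : m \in msupp (a * val g) -> lev N m \in V.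
  case/msuppMP => [b [b' [_ /msupp_tval/andP[b'V _] ->]]].
  by apply: uV b'V; apply: lev_addl.
pose j (g : X) : Y := to_tpoly cY (val (g : tpoly R cX)).
pose f (g : X) : E := val (g : tpoly R cX) *: x.
have jlin : linear j.
  move=> a g h; apply: val_inj; apply/mpolyP => m.
  rewrite /= [LHS]mcoeff_trunc !mcoeffD !mcoeff_trunc -/(val _) XYE.
  case: ifP => mY; last by rewrite add0r.
  congr (_ + _); case: ifP => // /negbT mX.
  apply/esym/memN_msupp_eq0; apply: contra mX => /mulV mV.
  by rewrite /= mV.
have flin : linear f.
  move=> a g h; rewrite /f raddfD scalerDl scalerA; congr (_ + _).
  (* The terms lost in truncation have level in both [U] and [V], hence kill [x]. *)
  apply/eqP; rewrite -subr_eq0 -scalerBl; apply/eqP/scaler_msupp => m.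
  rewrite mcoeff_msupp mcoeffB [X in X - _]mcoeff_trunc.
  case: ifP => [_|/negbT mX]; first by rewrite subrr eqxx.
  rewrite sub0r oppr_eq0 -mcoeff_msupp => /mulV mV.
  by apply: Nx; rewrite inE mV andbT; move: mX; rewrite /= mV /= negbK.
have jgr : graded_map (mk_linear jlin : {linear X -> Y}).
  by move=> d g gd m; rewrite /= -/(val _) XYE; apply: gd.
have fgr : graded_map (mk_linear flin : {linear X -> E}).
  move=> d g gd /=; rewrite -[d](subrK p); apply: gcompZ px => m /gd <-.
  by rewrite addrK.
have jinj : injective (mk_linear jlin).
  by move=> g h /(congr1 val) /=; rewrite -!/(val _) !XYE => /val_inj.
have [g [ggr gj]] := injE X Y _ _ jgr jinj fgr.
pose e : Y := to_tpoly cY 1.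
have ge m : 'X_[m] *: g e = g (to_tpoly cY 'X_[m]).
  rewrite -linearZ; congr (g _); apply: val_inj => /=.
  rewrite [LHS]trunc_mulr ?mulr1 // => a b; apply: contra.
  by apply: uU; apply: lev_addl.
have truncU m : lev N m \in U -> to_tpoly cY 'X_[R, m] = 0.
  move=> mU; apply: val_inj; apply/mpolyP => k; rewrite mcoeff_trunc mcoeffX.
  by rewrite [RHS]mcoeff0; case: eqP => [<-|_]; rewrite /= ?mU ?if_same.
have py : gcomp p (g e).
  apply: ggr => m; rewrite msupp_trunc mcoeff_msupp mcoeff1 => /andP[_].
  case: (m =P 0%MM) => [->|_]; last by rewrite eqxx.
  by rewrite /multideg big1 ?add0r // => i _; rewrite mnm0E mulr0n.
exists (g e), (x - g e); split=> //; last by rewrite addrC subrK.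
- exact: gcompB.
- by exists N => m mU; rewrite ge truncU // linear0.
(* A monomial of level in [V] either has level in [U] too, and kills both terms, or is an element of
   [X], where [g] extends [f]. *)
exists N => m mV; rewrite scalerBr ge; have [mU|mU] := boolP (lev N m \in U).
  by rewrite truncU // linear0 subr0 Nx // inE mU.
have XE : trunc PX 'X_[R, m] = 'X_[m].
  apply/mpolyP => k; rewrite mcoeff_trunc mcoeffX.
  by case: eqP => [<-|_]; rewrite /= ?mV ?mU ?if_same.
have <- : (mk_linear jlin) (to_tpoly cX 'X_[m]) = to_tpoly cY 'X_[m].
  by apply: val_inj; rewrite /= XE.
by rewrite gj /= /f /= XE subrr.
Qed.
End Torsion.

(** * Mayer-Vietoris *)

Section MayerVietoris.
Variables (R : comNzRingType) (n r : nat) (deg : 'I_n -> 'rV[int]_r).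
Variables (M : gmod R deg) (E : injective_resolution M) (p : 'rV[int]_r).

Lemma gcompD (N : gmod R deg) d (x y : N) :
  gcomp d x -> gcomp d y -> gcomp d (x + y).
Proof.
move=> dx dy; rewrite -[y]opprK; apply: gcompB => //; rewrite -sub0r.
by apply: gcompB => //; apply: gcomp0.
Qed.

Lemma utorsD U (N : lmodType {mpoly R[n]}) (x y : N) :
  upset U -> utors U x -> utors U y -> utors U (x + y).
Proof.
move=> uU Ux Uy; rewrite -[y]opprK; apply: utorsB => //; rewrite -sub0r.
by apply: utorsB => //; apply: utors0.
Qed.

Definition ucoboundary (U : {set {set 'I_n}}) (i : nat) : E i -> Prop :=
  match i return E i -> Prop with
  | 0%N => fun x => x = 0
  | j.+1 => fun x =>
      exists y : E j, [/\ gcomp p y, utors U y & x = res_diff E j y]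
  end.

Definition uvanish (U : {set {set 'I_n}}) (i : nat) : Prop :=
  forall x : E i, gcomp p x -> utors U x -> res_diff E i x = 0 ->
  ucoboundary U x.

Lemma res_diffK i (x : E i) : res_diff E i.+1 (res_diff E i x) = 0.
Proof. by apply/res_exactS; exists x. Qed.

Lemma utorsS (U V : {set {set 'I_n}}) (N : lmodType {mpoly R[n]}) (x : N) :
  U \subset V -> utors V x -> utors U x.
Proof. by move=> /subsetP UV [k kx]; exists k => m /UV /kx. Qed.

(** Split a cocycle as [x = y + z]. The differential of [y] is minus that of [z], so it is torsion
    for both [U] and [V] and bounds some [w] by vanishing in degree [i.+1]. Then [y - w] and [z + w]
    are cocycles for [U] and [V] with sum [x]. *)
Lemma uvanishI U V i : upset U -> upset V ->
  uvanish U i -> uvanish V i -> uvanish (U :|: V) i.+1 -> uvanish (U :&: V) i.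
Proof.
move=> uU uV hU hV hUV x px tx dx.
have [y [z [py pz ty tz xE]]] :=
  utorsI_decomp uU uV (@res_injective _ _ _ _ _ E i) px tx.
have dyz : res_diff E i y = res_diff E i (- z).
  by apply/eqP; rewrite linearN -subr_eq0 opprK -linearD -xE dx.
have [w [pw tw dw]] : ucoboundary (U :|: V) (res_diff E i y).
  apply: hUV; [exact: res_diff_graded | | exact: res_diffK].
  apply/utorsU => //; split; first exact: utors_linear.
  by rewrite dyz; apply: utors_linear; rewrite -sub0r; apply: utorsB => //;
    apply: utors0.
have [twU twV] := (utorsU w uU uV).1 tw.
have cy : ucoboundary U (y - w).
  by apply: hU; [exact: gcompB | exact: utorsB | rewrite linearB dw subrr].
have cz : ucoboundary V (z + w).
  apply: hV; [exact: gcompD | exact: utorsD |].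
  by rewrite linearD -dw dyz -linearD subrr linear0.
have {dw hU hV hUV dyz} xE : x = (y - w) + (z + w).
  by rewrite xE addrACA [- w + w]addrC subrr addr0.
rewrite {}xE in px tx dx *.
(* In cohomological degree 0 both cocycles vanish; above it their primitives are added. *)
case: i x y z w px tx dx py pz ty tz pw tw twU twV cy cz => [|i] x y z w _ _ _.
  by move=> _ _ _ _ _ _ _ _ /= -> ->; rewrite addr0.
move=> _ _ _ _ _ _ _ _ [a [pa ta ->]] [b [pb tb ->]].
exists (a + b); split; [exact: gcompD | | by rewrite linearD].
apply: utorsD; first exact: upsetI.
  by apply: utorsS ta; apply: subsetIl.
by apply: utorsS tb; apply: subsetIr.
Qed.

(* The auxiliary [W] lets the induction absorb the sum term of Mayer-Vietoris. *)
Lemma uvanish_bigcap (t : nat) (U : 'I_t -> {set {set 'I_n}}) (js : seq 'I_t)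
    (W : {set {set 'I_n}}) (i : nat) :
  (forall j, upset (U j)) -> upset W -> uniq js ->
  (forall I : {set 'I_t}, I != set0 -> {subset I <= js} ->
     uvanish (\bigcup_(j in I) U j :|: W) (i + #|I| - 1)) ->
  uvanish (\bigcap_(j <- js) U j :|: W) i.
Proof.
move=> uU; elim: js W i => [|j js IH] W i uW.
  (* The empty intersection is [setT], for which only 0 is torsion. *)
  rewrite big_nil setTU => _ _ x _ /utorsT -> _.
  case: i x => [|i] x //=; exists 0; split; last by rewrite linear0.
    exact: gcomp0.
  exact: utors0.
rewrite /= => /andP[jjs ujs] H.
have ucap : upset (\bigcap_(j <- js) U j).
  elim: (js) => [|k ks IHk]; first by rewrite big_nil => s s'; rewrite !inE.
  by rewrite big_cons; apply: upsetI.
rewrite big_cons setUIl; apply: uvanishI.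
- exact: upsetU.
- exact: upsetU.
(* For a singleton the index [i + #|I| - 1] is [i]. *)
- have := H [set j]; rewrite big_set1 cards1 addnK; apply.
    by apply/set0Pn; exists j; rewrite inE.
  by move=> k /set1P ->; rewrite inE eqxx.
- apply: IH => // I I0 Ijs; apply: H => // k /Ijs.
  by rewrite inE => ->; rewrite orbT.
(* The sum term is again an intersection over [js], now joined with [U j :|: W]. Passing from [I] to
   [j |: I] raises the cardinality by one, which matches the rise from [i] to [i.+1]. *)
rewrite setUACA setUid [U j :|: _]setUC -setUA.
apply: IH => //; first exact: upsetU.
move=> I I0 Ijs.
have jI : j \notin I by apply: contra jjs => /Ijs.
have := H (j |: I); rewrite big_setU1 //= cardsU1 jI.
rewrite setUA [_ :|: U j]setUC addnA addn1; apply.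
  by apply/set0Pn; exists j; rewrite !inE eqxx.
by move=> k /setU1P[->|/Ijs kjs]; rewrite inE ?eqxx ?kjs ?orbT.
Qed.

End MayerVietoris.

(** * Monomial ideals *)

Section MonomialTorsion.
Variables (R : comNzRingType) (n r : nat) (deg : 'I_n -> 'rV[int]_r).
Local Notation S := {mpoly R[n]}.

Definition monomial_closed (J : S -> Prop) : Prop :=
  forall f m, J f -> m \in msupp f -> J 'X_[m].

(* The supports of the monomials of [J], that is, the squarefree monomials of
   the radical of [J]. *)
Definition radset (J : S -> Prop) (U : {set {set 'I_n}}) : Prop :=
  forall s, s \in U <-> exists m, J 'X_[m] /\ lev 1 m \subset s.

(** Membership in [J] need not be decidable, so excluded middle is applied to each of the finitely
    many supports. *)
Lemma radset_exists J : exists U, radset J U.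
Proof.
have [b hb] : exists b : {set 'I_n} -> bool, forall s,
    b s <-> exists m, J 'X_[m] /\ lev 1 m \subset s.
  apply: (@fin_all_exists _ (fun=> bool) (fun s b => b <-> _)) => s.
  by case: (classic (exists m, J 'X_[m] /\ lev 1 m \subset s)) => h;
    [exists true | exists false].
by exists [set s | b s] => s; rewrite inE.
Qed.

Lemma radset_upset J U : radset J U -> upset U.
Proof.
move=> JU s s' ss' /JU [m [Jm ms]]; apply/JU; exists m; split=> //.
exact: subset_trans ss'.
Qed.

Lemma generated_is_ideal (A : comNzRingType) (X : A -> Prop) :
  is_ideal (generated_ideal X).
Proof.
split.
- exists 0%N, (fun=> 0), (fun=> 0); split; [by case | by rewrite big_ord0].
- move=> _ _ [k [a [g [gX ->]]]] [k' [a' [g' [gX' ->]]]].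
  pose cat (u : 'I_k -> A) (u' : 'I_k' -> A) (i : 'I_(k + k')) :=
    match split i with inl i => u i | inr i => u' i end.
  exists (k + k')%N, (cat a a'), (cat g g'); split.
    by move=> i; rewrite /cat; case: (split i).
  rewrite big_split_ord; congr (_ + _); apply: eq_bigr => i _; rewrite /cat.
    by rewrite (unsplitK (inl i : 'I_k + 'I_k')%type).
  by rewrite (unsplitK (inr i : 'I_k + 'I_k')%type).
move=> b _ [k [a [g [gX ->]]]]; exists k, (fun j => b * a j), g; split=> //.
by rewrite mulr_sumr; apply: eq_bigr => j _; rewrite mulrA.
Qed.

Lemma generated_in (A : comNzRingType) (X : A -> Prop) f :
  X f -> generated_ideal X f.
Proof.
move=> Xf; exists 1%N, (fun=> 1), (fun=> f); split=> //.
by rewrite big_ord1 mul1r.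
Qed.

Lemma monomial_ideal_is_ideal (J : S -> Prop) :
  is_monomial_ideal J -> is_ideal J.
Proof.
case=> X hJ; have [G0 GD GM] := generated_is_ideal
  (fun h : S => exists m, X m /\ h = 'X_[m]).
split; first exact/hJ.
  by move=> a b /hJ Ja /hJ Jb; apply/hJ/GD.
by move=> a b /hJ Jb; apply/hJ/GM.
Qed.

Lemma monomial_ideal_closed (J : S -> Prop) :
  is_monomial_ideal J -> monomial_closed J.
Proof.
move=> mJ; have [_ _ JM] := monomial_ideal_is_ideal mJ.
case: mJ => X hJ f m /hJ[k [a [g [gX ->]]]] /msupp_sum_le.
case/flattenP => l /mapP[j _ ->] /msuppMP[b [b' [_ b'g ->]]].
rewrite mpolyXD; apply: JM; apply/hJ/generated_in; exists b'; split=> //.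
by have [m' [Xm' gE]] := gX j; move: b'g; rewrite gE msuppX inE => /eqP ->.
Qed.

Lemma ideal_sum_closed (t : nat) (B : 'I_t -> S -> Prop) (I : {set 'I_t}) :
  (forall j, is_monomial_ideal (B j)) -> monomial_closed (ideal_sum B I).
Proof.
move=> mB f m [b [bB ->]] /msupp_sum_le /flattenP[l /mapP[j]].
rewrite mem_filter => /andP[jI _] -> mb.
exists (fun i => if i == j then 'X_[m] else 0); split.
  move=> i iI; case: eqP => [->|_].
    exact: (monomial_ideal_closed (mB j) (bB _ jI)).
  by have [] := monomial_ideal_is_ideal (mB i).
rewrite (bigD1 j) //= eqxx big1 ?addr0 // => i /andP[_ /negPf ->] //.
Qed.

Lemma radset_ideal_sum (t : nat) (B : 'I_t -> S -> Prop)
    (U : 'I_t -> {set {set 'I_n}}) (I : {set 'I_t}) :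
  (forall j, is_monomial_ideal (B j)) -> (forall j, radset (B j) (U j)) ->
  radset (ideal_sum B I) (\bigcup_(j in I) U j).
Proof.
move=> mB BU s; split.
  case/bigcupP => j jI /BU[m [Bm ms]]; exists m; split=> //.
  exists (fun i => if i == j then 'X_[m] else 0); split.
    move=> i iI; case: eqP => [-> //|_].
    by have [] := monomial_ideal_is_ideal (mB i).
  by rewrite (bigD1 j) //= eqxx big1 ?addr0 // => i /andP[_ /negPf ->].
move=> [m [[b [bB mE]] ms]].
have : m \in msupp ('X_[m] : S) by rewrite msuppX inE.
rewrite mE => /msupp_sum_le /flattenP[l /mapP[j]].
rewrite mem_filter => /andP[jI _] -> mb; apply/bigcupP; exists j => //.
apply/BU; exists m; split=> //.
exact: (monomial_ideal_closed (mB j) (bB _ jI)).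
Qed.

Lemma ideal_sum_ideal (t : nat) (B : 'I_t -> S -> Prop) (I : {set 'I_t}) :
  (forall j, is_monomial_ideal (B j)) -> is_ideal (ideal_sum B I).
Proof.
move=> mB; split.
- exists (fun=> 0); split; last by rewrite big1.
  by move=> j _; have [] := monomial_ideal_is_ideal (mB j).
- move=> _ _ [a [aB ->]] [b [bB ->]]; exists (fun j => a j + b j).
  split; last by rewrite big_split.
  move=> j jI; have [_ D _] := monomial_ideal_is_ideal (mB j).
  by apply: D; [apply: aB | apply: bB].
move=> a _ [b [bB ->]]; exists (fun j => a * b j); split; last exact: mulr_sumr.
by move=> j /bB bj; have [_ _ D] := monomial_ideal_is_ideal (mB j); apply: D.
Qed.

(* If the level [s] of [m] is not in [U], then every monomial of [J] involves a
   variable outside [s], so a monomial of [J ^ k] has degree at least [k] in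
   these variables, whereas [m] has degree at most [n * N] in them. *)
Lemma ideal_pow_lev (J : S -> Prop) U (N : nat) f m :
  monomial_closed J -> radset J U -> ideal_pow J (n * N).+1 f ->
  m \in msupp f -> lev N m \in U.
Proof.
move=> cJ JU [k [a [g [gJ ->]]]] /msupp_sum_le /flattenP[l /mapP[j _ ->]].
case/msuppMP => [b [b' [_ b'g mE]]]; apply/negPn/negP => mU.
pose s := lev N m.
pose wt (m' : 'X_{1..n}) := (\sum_(i in ~: s) m' i)%N.
have wtD a1 a2 : wt (a1 + a2)%MM = (wt a1 + wt a2)%N.
  by rewrite -big_split; apply: eq_bigr => i _; rewrite mnmDE.
have wtJ h c : J h -> c \in msupp h -> (0 < wt c)%N.
  move=> Jh ch; rewrite lt0n; apply: contra mU => /eqP wc.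
  apply/JU; exists c; split; first exact: cJ ch.
  apply/subsetP => i; rewrite inE => ci; apply: contraLR ci => si.
  by rewrite -ltnNge ltnS -wc /wt (bigD1 i) ?leq_addr // inE.
have wtpow K (h : 'I_K -> S) c : (forall i, J (h i)) ->
    c \in msupp (\prod_(i < K) h i) -> (K <= wt c)%N.
  elim: K h c => [//|K IH] h c hJ; rewrite big_ord_recl.
  case/msuppMP => [c1 [c2 [/(wtJ _ _ (hJ _)) c1h /IH c2h ->]]].
  by rewrite wtD -add1n leq_add // c2h.
have := gJ j => -[h [hJ gE]]; rewrite gE in b'g.
have {b'g wtJ} := wtpow _ _ _ hJ b'g.
have : (wt m <= n * N)%N.
  rewrite -[X in (_ <= X * _)%N]card_ord -sum_nat_const.
  rewrite [leqRHS](bigID (mem (~: s))) /=.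
  apply: leq_trans (leq_addr _ _); apply: leq_sum => i.
  by rewrite !inE -ltnNge => /ltnW.
rewrite mE wtD => h1 h2; have := leq_trans h2 (leq_trans (leq_addl _ _) h1).
by rewrite ltnn.
Qed.

(** The powers of [J] and the ideals spanned by monomials of level in [U] are cofinal:
    [ideal_pow_lev] gives one direction, and divisibility by powers of chosen monomials of [J] the
    other. *)
Lemma torsion_utors (J : S -> Prop) U (N : gmod R deg) (x : N) :
  is_ideal J -> monomial_closed J -> radset J U ->
  torsion J x <-> utors U x.
Proof.
move=> [_ _ JM] cJ JU; split=> [[k kx]|[k kx]]; last first.
  exists (n * k).+1 => a Ja; apply: scaler_msupp => m ma.
  by apply/kx/(ideal_pow_lev cJ JU Ja).
have [c hc] : exists c : {set 'I_n} -> 'X_{1..n}, forall s,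
    s \in U -> J 'X_[c s] /\ lev 1 (c s) \subset s.
  apply: (@fin_all_exists _ (fun=> 'X_{1..n})
    (fun s m => s \in U -> J 'X_[m] /\ lev 1 m \subset s)) => s.
  have [/JU[m hm]|sU] := boolP (s \in U); first by exists m.
  by exists 0%MM.
(* This threshold bounds every exponent of every [c s *+ k], so a monomial of level [s] in [U] is
   divisible by the [k]-th power of ['X_[c s]]. *)
exists (\sum_s mdeg (c s) * k)%N => m mU.
set N0 := (\sum_s _)%N in mU; pose s := lev N0 m.
have [Jc cs] := hc s mU.
have cm : (c s *+ k <= m)%MM.
  apply/mnm_lepP => i; rewrite mulmnE.
  have [->//|ci] := posnP (c s i).
  have : i \in s by apply: (subsetP cs); rewrite inE.
  rewrite inE; apply: leq_trans.
  rewrite /N0 (bigD1 s) //=; apply: leq_trans (leq_addr _ _).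
  by rewrite leq_mul2r mdegE (bigD1 i) //= leq_addr orbT.
rewrite -(submK cm) mpolyXD -scalerA kx ?scaler0 // -mpolyXn.
apply: generated_in; exists (fun=> 'X_[c s]); split=> //.
by rewrite prodr_const card_ord.
Qed.

Lemma lc_zero_uvanish (J : S -> Prop) U (M : gmod R deg) i p :
  is_ideal J -> monomial_closed J -> radset J U ->
  lc_zero J M i p <-> forall E : injective_resolution M, uvanish E p U i.
Proof.
move=> iJ cJ JU.
have tE (N : gmod R deg) (x : N) : torsion J x <-> utors U x.
  exact: torsion_utors.
split=> H E x.
  move=> px /tE tx dx; have := H E x (And3 px tx dx).
  case: i x {H px tx dx} => [//|i] x [y [py /tE ty ->]].
  by exists y.
case=> px /tE tx dx; have := H E x px tx dx.
case: i x {H px tx dx} => [//|i] x [y [py /tE ty ->]].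
by exists y.
Qed.

End MonomialTorsion.

(** * Primes of [R], and primes of [S] above 0/1 points *)

Lemma prime_ideal_exists (R : comNzRingType) :
  exists p : R -> Prop, is_prime_ideal p.
Proof.
(* Membership of 0 is left out so that the empty union of the empty chain satisfies [P]. Maximality
   restores it, since a [p] without 0 would be empty and smaller than the zero ideal. *)
pose P (J : R -> Prop) := [/\ forall a b, J a -> J b -> J (a + b),
  forall a b, J b -> J (a * b) & ~ J 1].
have [F FP Ft|p [[pD pM p1] pmax]] := @classical_sets.Zorn_bigcup R P.
  split.
  - move=> a b [X FX Xa] [Y FY Yb].
    have [XY|YX] := Ft _ _ FX FY.
      by exists Y => //; have [D _ _] := FP _ FY; apply: D => //; apply: XY.
    by exists X => //; have [D _ _] := FP _ FX; apply: D => //; apply: YX.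
  - by move=> a b [X FX Xb]; exists X => //; have [_ D _] := FP _ FX; apply: D.
  by case=> X FX X1; have [_ _] := FP _ FX.
have p0 : p 0.
  apply: NNPP => np0.
  have pE a : ~ p a by move=> /(pM 0); rewrite mul0r.
  apply: (pmax (fun a => a = 0)).
    by split=> [a /pE//|/(_ 0 erefl)/pE].
  split=> [a b -> ->|a b ->|/eqP]; rewrite ?addr0 ?mulr0 //.
  by rewrite oner_eq0.
have inv a : ~ p a -> exists b c, p c /\ c + b * a = 1.
  move=> npa; apply: NNPP => nbc.
  apply: (pmax (fun x => exists c b, p c /\ x = c + b * a)).
    split=> [x px|H]; first by exists x, 0; rewrite mul0r addr0.
    by apply: npa; apply: H; exists 0, 1; rewrite add0r mul1r.
  split.
  - move=> _ _ [c [b [pc ->]]] [c' [b' [pc' ->]]].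
    exists (c + c'), (b + b'); split; first exact: pD.
    by rewrite mulrDl addrACA.
  - move=> x _ [c [b [pc ->]]]; exists (x * c), (x * b); split; first exact: pM.
    by rewrite mulrDr mulrA.
  by case=> c [b [pc E]]; apply: nbc; exists b, c.
exists p; split=> // a b pab; apply: NNPP => /not_or_and[/inv[a' [c [pc Ea]]]].
case/inv => b' [c' [pc' Eb]]; apply: p1.
(* Expand 1 as the product [(c + a' * a) * (c' + b' * b)]: every term lies in [p]. *)
rewrite -[1]mulr1 -{1}Ea -Eb mulrDl mulrDr.
apply: (pD); first by rewrite -mulrDr mulrC; apply: (pM).
rewrite mulrDr; apply: (pD); first exact: pM.
by rewrite mulrACA; apply: pM.
Qed.

Section CoordinatePrimes.
Variables (R : comNzRingType) (n : nat) (p : R -> Prop).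
Hypothesis pp : is_prime_ideal p.
Local Notation S := {mpoly R[n]}.

(** The point is 0 on [W] and 1 off it, so each monomial evaluates to 0 or 1 and one prime of [R]
    serves to test all supports. *)
Definition coord_prime (W : {set 'I_n}) (f : S) : Prop :=
  p f.@[fun i => (i \notin W)%:R].

Lemma coord_prime_prime W : is_prime_ideal (coord_prime W).
Proof.
have [[p0 pD pM] p1 pr] := pp; rewrite /coord_prime; split.
- split=> [|f g|f g]; first by rewrite meval0.
    by rewrite mevalD; apply: pD.
  by rewrite mevalM; apply: pM.
- by rewrite meval1.
by move=> f g; rewrite mevalM; apply: pr.
Qed.

Lemma coord_primeX W m : coord_prime W 'X_[m] <-> ~ (lev 1 m \subset ~: W).
Proof.
have [[p0 _ _] p1 _] := pp; rewrite /coord_prime mevalX; split.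
  move=> pm mW; apply: p1; rewrite big1 // in pm => i _.
  have [->//|mi] := posnP (m i).
  have : i \in ~: W by apply: (subsetP mW); rewrite inE.
  by rewrite inE => ->; rewrite expr1n.
move/negP/subsetPn => [i]; rewrite !inE negbK => mi iW.
by rewrite (bigD1 i) //= iW expr0n -leqn0 leqNgt mi mul0r.
Qed.

Lemma in_V_coord_prime (J : S -> Prop) U W :
  is_ideal J -> monomial_closed J -> radset J U ->
  in_V J (coord_prime W) <-> ~: W \notin U.
Proof.
move=> iJ cJ JU; have pr := coord_prime_prime W; split.
  case=> _ JP; apply/negP => /JU[m [Jm mW]].
  by have /coord_primeX := JP _ Jm.
move=> WU; split=> // f Jf; have [[P0 PD PM] _ _] := pr.
rewrite (mpolyE f) big_seq; apply: big_ind => // m mf.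
rewrite -mul_mpolyC; apply: PM; apply/coord_primeX => mW.
by case/negP: WU; apply/JU; exists m; split=> //; apply: cJ mf.
Qed.

End CoordinatePrimes.

(** * Degree bounds *)

Section Degrees.
Variables (r l : nat) (c : 'I_l.+1 -> 'rV[int]_r) (v : 'rV[int]_r).

Lemma dot_is_zmod_morphism : zmod_morphism (dot v).
Proof.
move=> a b; rewrite /dot -sumrB; apply: eq_bigr => k _.
by rewrite !mxE mulrDr mulrN.
Qed.

HB.instance Definition _ := GRing.isZmodMorphism.Build _ _ (dot v)
  dot_is_zmod_morphism.

Lemma dot_le_max j : dot v (c j) <= max_dot c v.
Proof. exact: le_bigmax. Qed.

Lemma min_le_dot j : min_dot c v <= dot v (c j).
Proof. exact: bigmin_le. Qed.

(** For [i <= 1] the left side is at most 0 once [k > 0], while [dot v d >= 0]; the case [i = k = 0]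
    uses the minimum. For [i >= 2] the subtracted [i - 1] generators cost at most [i - 1 <= k - 1]
    times the maximum. *)
Lemma dot_NCshift i k d : (forall j, 0 <= dot v (c j)) -> (i <= k)%N ->
  NCshift c (1 - i%:Z) d -> (1 - k%:Z) * slope c v k <= dot v d.
Proof.
move=> c0 ik [w [u [sw [w' ->] ->]]].
have dotw (w0 : 'I_l.+1 -> nat) :
    dot v (\sum_j c j *+ w0 j) = \sum_j dot v (c j) *+ w0 j.
  by rewrite raddf_sum; apply: eq_bigr => j _; rewrite raddfMn.
have dot0 (w0 : 'I_l.+1 -> nat) : 0 <= dot v (\sum_j c j *+ w0 j).
  by rewrite dotw; apply: sumr_ge0 => j _; apply: mulrn_wge0.
have max0 : 0 <= max_dot c v by apply: le_trans (c0 ord0) (dot_le_max _).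
have slope0 : (0 < k)%N -> (1 - k%:Z) * slope c v k <= 0.
  case: k {ik} => [//|[|k]] _; first by rewrite subrr mul0r.
  have kn : 1 - k.+2%:Z < 0 by rewrite subr_lt0 ltz_nat.
  by rewrite /slope kn mulr_le0_ge0 // ltW.
rewrite raddfD raddfMz -[leLHS]addr0 lerD ?dot0 // {w' dot0}.
have sum_le : dot v (\sum_j c j *+ w j) <= max_dot c v *+ \sum_j w j.
  by rewrite dotw -sumrMnr ler_sum // => j _; rewrite lerMn2r dot_le_max orbT.
have sum_ge : min_dot c v *+ \sum_j w j <= dot v (\sum_j c j *+ w j).
  by rewrite dotw -sumrMnr ler_sum // => j _; rewrite lerMn2r min_le_dot orbT.
have sum0 : 0 <= dot v (\sum_j c j *+ w j).
  by rewrite dotw; apply: sumr_ge0 => j _; apply: mulrn_wge0.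
move: sum_le sum_ge sum0; rewrite sw {sw dotw}; set D := dot v _.
case: i ik => [|[|i]] ik.
- rewrite subr0 mulr1z => _ minD D0.
  case: k ik slope0 => [|k] _ slope0; first by rewrite subr0 mul1r.
  exact: le_trans (slope0 isT) D0.
- by rewrite subrr mulr0z => _ _ _; apply: slope0.
have kn : 1 - k%:Z < 0 by rewrite subr_lt0 ltz_nat (leq_trans _ ik).
have iE : 1 - i.+2%:Z = - i.+1%:Z.
  by rewrite -[i.+2]addn1 PoszD opprD addrCA subrr addr0.
rewrite /slope kn iE abszN absz_nat sgzN [sgz _](_ : _ = 1) // mulrN1z.
move=> maxD _ _; apply: le_trans (_ : - (max_dot c v *+ i.+1) <= _); last first.
  by rewrite lerN2.
rewrite -mulr_natr -mulrN mulrC; apply: ler_wpM2l => //.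
by rewrite natz -iE lerD2l lerN2 lez_nat.
Qed.
End Degrees.

(** * Comparison of the regularity regions *)

Theorem proposition5p6 (R : comNzRingType) (hR : noetherian R) (n r : nat)
    (deg : 'I_n -> 'rV[int]_r)
    (t : nat) (B : 'I_t -> {mpoly R[n]} -> Prop)
    (hB : forall j, is_monomial_ideal (B j))
    (l : nat) (c : 'I_l.+1 -> 'rV[int]_r)
    (v : {set 'I_t} -> 'rV[int]_r)
    (hv : forall I, I != set0 -> coarsening_vector deg (v I))
    (M : gmod R deg)
    (hvc : forall I, I != set0 -> forall j, 0 <= dot (v I) (c j)) :
  (forall m, reg_coarse c M B v m -> reg_family c M B m) /\
  (forall B0 : {mpoly R[n]} -> Prop, is_monomial_ideal B0 ->
     (forall P, in_V B0 P <-> exists j, in_V (B j) P) ->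
     forall m, reg_coarse c M B v m -> reg c M B0 m).
Proof.
have family m : reg_coarse c M B v m -> reg_family c M B m.
  move=> mreg i I I0 d dC; apply: (mreg _ I I0).
  rewrite [leRHS]raddfD lerD2l; apply: dot_NCshift dC; first exact: hvc.
  (* As [I] is nonempty, the index [i + #|I| - 1] is at least [i]. *)
  by rewrite -addnBA ?leq_addr // card_gt0.
split=> // B0 mB0 VB0 m /family mreg i d dC.
have [U BU] : exists U, forall j, radset (B j) (U j).
  apply: (@fin_all_exists _ (fun=> {set {set 'I_n}})
    (fun j V => radset (B j) V)) => j; apply: radset_exists.
have [U0 BU0] := radset_exists B0.
have mono_ideal J := @monomial_ideal_is_ideal R n J.
have mono_closed J := @monomial_ideal_closed R n J.
(* The union with [set0] matches the form of [uvanish_bigcap], started at [W = set0]. *)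
have U0E : U0 = \bigcap_(j <- enum 'I_t) U j :|: set0.
  have [p pp] := prime_ideal_exists R.
  have memV (J : {mpoly R[n]} -> Prop) V s : is_monomial_ideal J -> radset J V ->
      in_V J (coord_prime p (~: s)) <-> s \notin V.
    move=> mJ JV.
    have := in_V_coord_prime pp (~: s) (mono_ideal _ mJ) (mono_closed _ mJ) JV.
    by rewrite setCK.
  apply/setP => s; rewrite setU0 big_enum; apply/idP/bigcapP => sU.
    move=> j _; apply: contraTT sU => sj.
    by apply/(memV _ _ _ mB0 BU0)/VB0; exists j; apply/(memV _ _ _ (hB j) (BU j)).
  apply/negPn/negP => /(memV _ _ _ mB0 BU0)/VB0[j].
  by move/(memV _ _ _ (hB j) (BU j)); rewrite sU.
apply/(lc_zero_uvanish _ _ _ (mono_ideal _ mB0) (mono_closed _ mB0) BU0) => E.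
rewrite U0E; apply: uvanish_bigcap.
- by move=> j; apply: radset_upset (BU j).
- by move=> s s' _; rewrite inE.
- exact: enum_uniq.
move=> I I0 _; rewrite setU0.
have := mreg i I I0 d dC.
move/(lc_zero_uvanish _ _ _ (ideal_sum_ideal _ hB) (ideal_sum_closed hB)
  (radset_ideal_sum _ hB BU)); exact.
Qed.
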